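(* Let $(A,\succ,\prec,\Delta_{\succ,r},\Delta_{\prec,r})$ be a factorizable anti-dendriform bialgebra, and let $$T_{r}\oplus T_{\tau(r)}:A^{*}\to A\oplus A,\qquad (T_{r}\oplus T_{\tau(r)})(\zeta)=(T_{r}(\zeta),-T_{\tau(r)}(\zeta)).$$ Then $\mathrm{Im}(T_{r}\oplus T_{\tau(r)})$ is an anti-dendriform subalgebra of the direct sum anti-dendriform algebra $A\oplus A$, and it is isomorphic to the anti-dendriform algebra $(A^{*},\succ_{r},\prec_{r})$. Furthermore, any $x\in A$ has a unique decomposition $x=x_1-x_2$ with $(x_1,x_2)\in\mathrm{Im}(T_{r}\oplus T_{\tau(r)})$.
   Context: All vector spaces are finite-dimensional over a field $k$. An anti-dendriform algebra is a vector space $A$ with bilinear operations $\succ,\prec$ such that, writing $x\cdot y=x\succ y+x\prec y$, for all $x,y,z$: $x\succ(y\succ z)=-(x\cdot y)\succ z=-x\prec(y\cdot z)=(x\prec y)\prec z$ and $(x\succ y)\prec z=x\succ(y\prec z)$; then $(A,\cdot)$ is associative. For $\ast\in\{\succ,\prec,\cdot\}$: $L_\ast(x)y=x\ast y$, $R_\ast(x)y=y\ast x$. $\tau$ is the flip; $I$ is the identity. For $f:A\to\mathrm{End}(V)$, $f^*:A\to\mathrm{End}(V^* )$ is $\langle f^*(x)u^*,v\rangle=\langle u^*,f(x)v\rangle$ (no sign). For $r\in A\otimes A$, $T_r:A^*\to A$ is defined by $\langle T_r(\zeta),\eta\rangle=\langle r,\zeta\otimes\eta\rangle$. Invariance: $s\in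 A\otimes A$ is invariant if $(R_{\prec}(x)\otimes I+I\otimes L_{\cdot}(x))s=0$ and $(R_{\cdot}(x)\otimes I+I\otimes L_{\succ}(x))s=0$ for all $x\in A$. AD-YBE: for $r=\sum_i a_i\otimes b_i$, $\sum_{i,j}\big(a_i\cdot a_j\otimes b_i\otimes b_j+a_j\otimes (a_i\succ b_j)\otimes b_i-a_i\otimes a_j\otimes (b_i\prec b_j)\big)=0$. Anti-dendriform bialgebra: a quintuple $(A,\succ,\prec,\Delta_\succ,\Delta_\prec)$ where $(A,\succ,\prec)$ is an anti-dendriform algebra; $\Delta_\succ,\Delta_\prec:A\to A\otimes A$ are linear maps such that the operations on $A^*$ given by $\langle x,\zeta\succ_{A^*}\eta\rangle=\langle\Delta_\succ(x),\zeta\otimes\eta\rangle$, $\langle x,\zeta\prec_{A^*}\eta\rangle=\langle\Delta_\prec(x),\zeta\otimes\eta\rangle$ make $A^*$ an anti-dendriform algebra; and, with $\Delta=\Delta_\succ+\Delta_\prec$, for all $x,y\in A$: (1) $\Delta_{\prec}(x\cdot y)=(R_{\cdot}(y)\otimes I)\Delta_{\prec}(x)-(I\otimes L_{\succ}(x))\Delta_{\prec}(y)$; (2) $\Delta_{\succ}(x\cdot y)=(I\otimes L_{\cdot}(x))\Delta_{\succ}(y)-(R_{\prec}(y)\otimes I)\Delta_{\succ}(x)$; (3) $\Delta(x\prec y)=(R_{\prec}(y)\otimes I)\Delta(x)-(I\otimes L_{\prec}(x))\Delta_{\succ}(y)$; (4) $\Delta(x\succ y)=(I\otimes L_{\succ}(x))\Delta(y)-(R_{\succ}(y)\otimes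 I)\Delta_{\prec}(x)$; (5) $(L_{\succ}(x)\otimes I)\Delta(y)+(R_{\succ}(y)\otimes I)\tau\Delta_{\succ}(x)-(I\otimes L_{\prec}(y))\tau\Delta_{\prec}(x)-(I\otimes R_{\prec}(x))\Delta(y)=0$; (6) $(I\otimes R_{\cdot}(y))\Delta_{\succ}(x)+(L_{\succ}(y)\otimes I)\Delta_{\succ}(x)-\tau(I\otimes R_{\prec}(x))\Delta_{\prec}(y)-\tau(L_{\cdot}(x)\otimes I)\Delta_{\prec}(y)=0$. If $r$ solves the AD-YBE and $r+\tau(r)$ is invariant, the anti-dendriform bialgebra $(A,\succ,\prec,\Delta_{\succ,r},\Delta_{\prec,r})$ with $\Delta_{\succ,r}(x)=-(R_{\prec}(x)\otimes I+I\otimes L_{\cdot}(x))r$, $\Delta_{\prec,r}(x)=(R_{\cdot}(x)\otimes I+I\otimes L_{\succ}(x))r$ is called quasi-triangular. It is called factorizable if moreover $T_{r+\tau(r)}:A^*\to A$ is a linear isomorphism. The operations dual to $\Delta_{\succ,r},\Delta_{\prec,r}$ on $A^*$ are $\zeta\succ_{r}\eta=-R_{\cdot}^{*}(T_{r}(\zeta))\eta-L_{\prec}^{*}(T_{\tau(r)}(\eta))\zeta$ and $\zeta\prec_{r}\eta=R_{\succ}^{*}(T_{r}(\zeta))\eta+L_{\cdot}^{*}(T_{\tau(r)}(\eta))\zeta$. The direct sum $A\oplus A$ has componentwise operations. *)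

(* Defs.v *)
From HB Require Import structures.
From mathcomp Require Import all_boot all_algebra.

Set Implicit Arguments.
Unset Strict Implicit.
Unset Printing Implicit Defensive.

Import GRing.Theory.
Local Open Scope ring_scope.

Notation dual V := 'Hom(V, GRing.regular _).

Section Bilinear.
Variable k : fieldType.
Implicit Types U V W : vectType k.

(* linfun returns a junk map on a non-linear argument; every use of bilin and
   linfun below is accompanied by a lemma giving its values. *)
Definition bilin U V W (f : U -> V -> W) : 'Hom(U, 'Hom(V, W)) :=
  linfun (fun u => linfun (f u) : 'Hom(V, W)).

Lemma linfunE U V (f : U -> V) : linear f -> linfun f =1 f.
Proof.
move=> fl u; pose m := GRing.isLinear.Build _ _ _ _ f fl.
by pose F : {linear U -> V} := HB.pack f m; rewrite (lfunE F).
Qed.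

Lemma bilinE U V W (f : U -> V -> W) :
  (forall u, linear (f u)) -> (forall v, linear (f^~ v)) ->
  forall u v, bilin f u v = f u v.
Proof.
move=> fr fl u v; rewrite /bilin linfunE ?linfunE //.
move=> a x y; apply/lfunP => w.
by rewrite add_lfunE scale_lfunE !linfunE //; apply: fl.
Qed.

End Bilinear.

(* Tensor product of finite-dimensional spaces, as coordinate arrays in the
   bases vbasis; tens_liftE and tens_lift_unique are its universal property. *)
Section Tensor.
Variable k : fieldType.
Implicit Types U V W : vectType k.

Definition tens U V : vectType k := 'M[k]_(\dim {:U}, \dim {:V}).

Definition pure U V (u : U) (v : V) : tens U V :=
  \matrix_(i, j) (coord (vbasis {:U}) i u * coord (vbasis {:V}) j v).

Definition tens_lift U V W (B : 'Hom(U, 'Hom(V, W))) : 'Hom(tens U V, W) :=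
  linfun (fun t : 'M[k]_(\dim {:U}, \dim {:V}) =>
    \sum_i \sum_j t i j *: B (vbasis {:U})`_i (vbasis {:V})`_j).

Lemma pure_linr U V (u : U) : linear (@pure U V u).
Proof.
by move=> a x y; apply/matrixP => i j; rewrite !mxE linearP mulrDr mulrCA.
Qed.

Lemma pure_linl U V (v : V) : linear (@pure U V ^~ v).
Proof.
by move=> a x y; apply/matrixP => i j; rewrite !mxE linearP mulrDl mulrA.
Qed.

Lemma tens_liftEx U V W (B : 'Hom(U, 'Hom(V, W))) t : tens_lift B t =
  \sum_i \sum_j (t : 'M[k]_(_, _)) i j *:
     B (vbasis {:U})`_i (vbasis {:V})`_j.
Proof.
rewrite /tens_lift linfunE // => a x y.
rewrite scaler_sumr -big_split; apply: eq_bigr => i _ /=.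
rewrite scaler_sumr -big_split; apply: eq_bigr => j _ /=.
by rewrite !mxE scalerDl scalerA.
Qed.

Lemma tens_liftE U V W (B : 'Hom(U, 'Hom(V, W))) u v :
  tens_lift B (pure u v) = B u v.
Proof.
rewrite tens_liftEx.
rewrite [in RHS](coord_vbasis (memvf u)) linear_sum sum_lfunE.
apply: eq_bigr => i _; rewrite linearZ scale_lfunE /=.
rewrite [in RHS](coord_vbasis (memvf v)) linear_sum scaler_sumr.
by apply: eq_bigr => j _; rewrite mxE linearZ /= scalerA.
Qed.

Lemma tens_basis U V (t : tens U V) :
  t = \sum_i \sum_j (t : 'M[k]_(_, _)) i j *:
     pure (vbasis {:U})`_i (vbasis {:V})`_j.
Proof.
rewrite {1}[t]matrix_sum_delta; apply: eq_bigr => i _; apply: eq_bigr => j _.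
congr (_ *: _); apply/matrixP => i' j'; rewrite !mxE.
rewrite !(coord_free _ _ (basis_free (vbasisP _))).
by rewrite -natrM mulnb ![i' == _]eq_sym ![j' == _]eq_sym.
Qed.

Lemma tens_lift_unique U V W (f g : 'Hom(tens U V, W)) :
  (forall u v, f (pure u v) = g (pure u v)) -> f = g.
Proof.
move=> fg; apply/lfunP => t; rewrite (tens_basis t) !linear_sum.
apply: eq_bigr => i _; rewrite !linear_sum; apply: eq_bigr => j _.
by rewrite !linearZ /= fg.
Qed.

Lemma tens_decomp U V (t : tens U V) :
  exists (n : nat) (a : 'I_n -> U) (b : 'I_n -> V),
    t = \sum_i pure (a i) (b i).
Proof.
exists (\dim {:U}), (fun i => (vbasis {:U})`_i),
  (fun i => \sum_j (t : 'M[k]_(_, _)) i j *: (vbasis {:V})`_j).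
rewrite {1}(tens_basis t); apply: eq_bigr => i _.
have E (w : V) : pure (vbasis {:U})`_i w = linfun (pure (vbasis {:U})`_i) w.
  by rewrite linfunE //; apply: pure_linr.
rewrite E linear_sum; apply: eq_bigr => j _.
by rewrite linearZ /= -E.
Qed.

Definition tens_map U U' V V' (f : 'Hom(U, U')) (g : 'Hom(V, V')) :
  'Hom(tens U V, tens U' V') :=
  tens_lift (bilin (fun u v => pure (f u) (g v))).

Definition tens_flip U V : 'Hom(tens U V, tens V U) :=
  tens_lift (bilin (fun u v => pure v u)).

(* The pairing <t, zeta (x) eta>. *)
Definition tens_pair U V (t : tens U V) (zeta : dual U) (eta : dual V) : k :=
  tens_lift (bilin (fun u v => (zeta u * eta v : k^o))) t.

Lemma tens_mapE U U' V V' (f : 'Hom(U, U')) (g : 'Hom(V, V')) u v :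
  tens_map f g (pure u v) = pure (f u) (g v).
Proof.
rewrite /tens_map tens_liftE bilinE // => w a x y; rewrite linearP.
  exact: pure_linr.
exact: pure_linl.
Qed.

Lemma tens_flipE U V (u : U) (v : V) : tens_flip U V (pure u v) = pure v u.
Proof.
by rewrite /tens_flip tens_liftE bilinE // => w; [apply: pure_linl|apply: pure_linr].
Qed.

Lemma tens_pairE U V (u : U) (v : V) (zeta : dual U) (eta : dual V) :
  tens_pair (pure u v) zeta eta = zeta u * eta v.
Proof.
rewrite /tens_pair tens_liftE bilinE // => w a x y; rewrite linearP.
  by rewrite mulrDr; congr (_ + _); apply: mulrCA.
by rewrite mulrDl; congr (_ + _); rewrite -mulrA.
Qed.

End Tensor.

Arguments tens_flip {k U V}.

Section AntiDendriform.
Variable k : fieldType.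
Implicit Types V W : vectType k.

(* Bilinear operations in curried form: the left multiplication L_*(x) is
   op x. *)
Definition Rmul V (op : 'Hom(V, 'End(V))) : 'Hom(V, 'End(V)) :=
  bilin (fun x y => op y x).

Lemma RmulE V (op : 'Hom(V, 'End(V))) x y : Rmul op x y = op y x.
Proof.
rewrite /Rmul bilinE // => w a u v; last by rewrite linearP.
by rewrite linearP add_lfunE scale_lfunE.
Qed.

Record ad_ops V := AdOps {
  succ : 'Hom(V, 'End(V));
  prec : 'Hom(V, 'End(V)) }.

Definition dot V (A : ad_ops V) : 'Hom(V, 'End(V)) := succ A + prec A.

Record is_antidendriform V (A : ad_ops V) : Prop := IsAntidendriform {
  ad_ss_ds : forall x y z,
    succ A x (succ A y z) = - succ A (dot A x y) z;
  ad_ds_pd : forall x y z,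
    - succ A (dot A x y) z = - prec A x (dot A y z);
  ad_pd_pp : forall x y z,
    - prec A x (dot A y z) = prec A (prec A x y) z;
  ad_sp_sp : forall x y z,
    prec A (succ A x y) z = succ A x (prec A y z) }.

Definition ad_sum V W (A : ad_ops V) (B : ad_ops W) : ad_ops (V * W)%type :=
  AdOps (bilin (fun u v : V * W => (succ A u.1 v.1, succ B u.2 v.2)))
        (bilin (fun u v : V * W => (prec A u.1 v.1, prec B u.2 v.2))).

Definition is_ad_subalgebra V (A : ad_ops V) (U : {vspace V}) : Prop :=
  forall u v, u \in U -> v \in U -> succ A u v \in U /\ prec A u v \in U.

(* The operations restricted to U, meaningful when U is a subalgebra. *)
Definition ad_sub V (A : ad_ops V) (U : {vspace V}) : ad_ops (subvs_of U) :=
  AdOps (bilin (fun u v : subvs_of U => vsproj U (succ A (vsval u) (vsval v))))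
        (bilin (fun u v : subvs_of U => vsproj U (prec A (vsval u) (vsval v)))).

Definition ad_isomorphic V W (A : ad_ops V) (B : ad_ops W) : Prop :=
  exists f : 'Hom(V, W), [/\ bijective f,
    forall x y, f (succ A x y) = succ B (f x) (f y)
  & forall x y, f (prec A x y) = prec B (f x) (f y)].

Lemma pair_bilinE V W (p : 'Hom(V, 'End(V))) (q : 'Hom(W, 'End(W))) u v :
  bilin (fun u v : V * W => (p u.1 v.1, q u.2 v.2)) u v
  = (p u.1 v.1, q u.2 v.2).
Proof.
rewrite bilinE // => w a x y /=; first by rewrite !linearP.
by rewrite !linearP /= !add_lfunE !scale_lfunE.
Qed.

Lemma ad_sumE V W (A : ad_ops V) (B : ad_ops W) u v :
  succ (ad_sum A B) u v = (succ A u.1 v.1, succ B u.2 v.2) /\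
  prec (ad_sum A B) u v = (prec A u.1 v.1, prec B u.2 v.2).
Proof. by split; apply: pair_bilinE. Qed.

Lemma ad_sum_is_antidendriform V W (A : ad_ops V) (B : ad_ops W) :
  is_antidendriform A -> is_antidendriform B -> is_antidendriform (ad_sum A B).
Proof.
have d u v : dot (ad_sum A B) u v = (dot A u.1 v.1, dot B u.2 v.2).
  by rewrite /dot !add_lfunE !(proj1 (ad_sumE _ _ _ _)) !(proj2 (ad_sumE _ _ _ _)).
move=> [a1 a2 a3 a4] [b1 b2 b3 b4].
split=> x y z; rewrite ?d !(proj1 (ad_sumE _ _ _ _), proj2 (ad_sumE _ _ _ _)) ?d.
- by rewrite a1 b1.
- by congr (_, _) => /=; [apply: a2 | apply: b2].
- by rewrite -a3 -b3.
- by rewrite a4 b4.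
Qed.

Lemma ad_sub_bilinE V (U : {vspace V}) (p : 'Hom(V, 'End(V)))
    (u v : subvs_of U) :
  bilin (fun u v : subvs_of U => vsproj U (p (vsval u) (vsval v))) u v
  = vsproj U (p (vsval u) (vsval v)).
Proof.
rewrite bilinE // => w a x y; first by rewrite !linearP.
by rewrite /= linearP add_lfunE scale_lfunE linearP.
Qed.

Lemma ad_subE V (A : ad_ops V) (U : {vspace V}) (u v : subvs_of U) :
  is_ad_subalgebra A U ->
  vsval (succ (ad_sub A U) u v) = succ A (vsval u) (vsval v) /\
  vsval (prec (ad_sub A U) u v) = prec A (vsval u) (vsval v).
Proof.
move=> AU; have [Us Up] := AU _ _ (subvsP u) (subvsP v).
by rewrite /= !ad_sub_bilinE !vsprojK.
Qed.

End AntiDendriform.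

Section Bialgebra.
Variables (k : fieldType) (V : vectType k).
Implicit Types (A : ad_ops V) (r s t : tens V V) (D : 'Hom(V, tens V V)).

(* The dual endomorphism without sign: f^*(x) is dual_end (f x). *)
Definition dual_end (f : 'End(V)) : 'End(dual V) :=
  linfun (fun u : dual V => (u \o f)%VF : dual V).

Lemma dual_endE (f : 'End(V)) (u : dual V) v : dual_end f u v = u (f v).
Proof.
rewrite /dual_end linfunE ?comp_lfunE // => a x y.
by apply/lfunP => w; rewrite !(add_lfunE, scale_lfunE, comp_lfunE).
Qed.

(* The operation on the dual space with
   <x, zeta * eta> = <D x, zeta (x) eta>. *)
Definition dual_op D : 'Hom(dual V, 'End(dual V)) :=
  bilin (fun zeta eta : dual V =>
           linfun (fun x => tens_pair (D x) zeta eta : k^o) : dual V).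

Lemma tens_pair_lin (zeta eta : dual V) :
  linear (fun t => tens_pair t zeta eta : k^o).
Proof. by move=> a x y; rewrite /tens_pair linearP. Qed.

Lemma tens_pair_linr t (zeta : dual V) :
  linear (fun eta : dual V => tens_pair t zeta eta : k^o).
Proof.
move=> a x y; rewrite (tens_basis t).
pose F z e : 'Hom(tens V V, k^o) := linfun (fun t => tens_pair t z e : k^o).
have FE z e u : tens_pair u z e = F z e u.
  by rewrite /F linfunE //; apply: tens_pair_lin.
rewrite !FE; suff -> : F zeta (a *: x + y) = a *: F zeta x + F zeta y.
  by rewrite add_lfunE scale_lfunE.
apply: tens_lift_unique => u v; rewrite add_lfunE scale_lfunE -!FE !tens_pairE.
by rewrite add_lfunE scale_lfunE mulrDr; congr (_ + _); apply: mulrCA.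
Qed.

Lemma tens_pair_linl t (eta : dual V) :
  linear (fun zeta : dual V => tens_pair t zeta eta : k^o).
Proof.
move=> a x y; rewrite (tens_basis t).
pose F z e : 'Hom(tens V V, k^o) := linfun (fun t => tens_pair t z e : k^o).
have FE z e u : tens_pair u z e = F z e u.
  by rewrite /F linfunE //; apply: tens_pair_lin.
rewrite !FE; suff -> : F (a *: x + y) eta = a *: F x eta + F y eta.
  by rewrite add_lfunE scale_lfunE.
apply: tens_lift_unique => u v; rewrite add_lfunE scale_lfunE -!FE !tens_pairE.
by rewrite add_lfunE scale_lfunE mulrDl; congr (_ + _); rewrite -mulrA.
Qed.

Lemma dual_opE D (zeta eta : dual V) x :
  dual_op D zeta eta x = tens_pair (D x) zeta eta.
Proof.
have L (z e : dual V) : linear (fun x => tens_pair (D x) z e : k^o).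
  by move=> a u v; rewrite linearP; apply: tens_pair_lin.
rewrite /dual_op bilinE ?linfunE // => z a u v; apply/lfunP => w;
  rewrite add_lfunE scale_lfunE !linfunE //.
  exact: tens_pair_linr.
exact: tens_pair_linl.
Qed.

(* T_r, through <T_r(zeta), eta> = <r, zeta (x) eta>: contraction of r with
   zeta on the first factor. *)
Definition Tmap r : 'Hom(dual V, V) :=
  linfun (fun zeta : dual V =>
    tens_lift (bilin (fun a b : V => (zeta a : k) *: b)) r).

Lemma Tmap_contrE (zeta : dual V) (a b : V) :
  tens_lift (bilin (fun a b : V => (zeta a : k) *: b)) (pure a b)
  = (zeta a : k) *: b.
Proof.
rewrite tens_liftE bilinE // => w c x y; first exact: linearP.
by rewrite linearP scalerDl scalerA.
Qed.

Lemma TmapE r (zeta eta : dual V) :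
  eta (Tmap r zeta) = tens_pair r zeta eta.
Proof.
pose C (z : dual V) : 'Hom(tens V V, V) :=
  tens_lift (bilin (fun a b : V => (z a : k) *: b)).
have CE z : Tmap r z = C z r.
  rewrite /Tmap linfunE // => a x y.
  suff CD : C (a *: x + y) = a *: C x + C y.
    by rewrite -[LHS]/(C (a *: x + y) r) CD add_lfunE scale_lfunE.
  apply: tens_lift_unique => u v; rewrite add_lfunE scale_lfunE !Tmap_contrE.
  by rewrite add_lfunE scale_lfunE scalerDl scalerA.
rewrite CE; pose P : 'Hom(tens V V, k^o) :=
  linfun (fun t => tens_pair t zeta eta : k^o).
have PE t : tens_pair t zeta eta = P t.
  by rewrite /P linfunE //; apply: tens_pair_lin.
rewrite PE -comp_lfunE; congr (fun_of_lfun _ r).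
apply: tens_lift_unique => u v.
by rewrite comp_lfunE Tmap_contrE linearZ /= -PE tens_pairE.
Qed.

Definition invariant A s : Prop := forall x,
  (tens_map (Rmul (prec A) x) \1 + tens_map \1 (dot A x))%VF s = 0 /\
  (tens_map (Rmul (dot A) x) \1 + tens_map \1 (succ A x))%VF s = 0.

Definition ybe_term A (a b a' b' : V) : tens (tens V V) V :=
  pure (pure (dot A a a') b) b'
  + pure (pure a' (succ A a b')) b
  - pure (pure a a') (prec A b b').

(* The triple tensor product is associated to the left. By tens_decomp every r
   is some \sum_i a_i (x) b_i, and by ADYBE_decomp the condition does not depend
   on the decomposition. *)
Definition ADYBE A r : Prop :=
  forall (n : nat) (a b : 'I_n -> V), r = \sum_i pure (a i) (b i) ->
  \sum_i \sum_j ybe_term A (a i) (b i) (a j) (b j) = 0.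

Lemma ADYBE_decomp A (n : nat) (a b : 'I_n -> V) :
  \sum_i \sum_j ybe_term A (a i) (b i) (a j) (b j) = 0 ->
  ADYBE A (\sum_i pure (a i) (b i)).
Proof.
have lin3 (W : lmodType k) c (x1 y1 x2 y2 x3 y3 : W) :
    c *: x1 + y1 + (c *: x2 + y2) - (c *: x3 + y3)
    = c *: (x1 + x2 - x3) + (y1 + y2 - y3).
  by rewrite !scalerDr scalerN opprD (addrACA (c *: x1)) [LHS]addrACA.
pose lE := (add_lfunE, scale_lfunE).
have l1 b1 a2 b2 : linear (fun a1 => ybe_term A a1 b1 a2 b2).
  move=> c x y; rewrite /ybe_term; move: (dot A) => D; rewrite -lin3.
  by congr (_ + _ - _); rewrite ?linearP ?lE !(pure_linl, pure_linr).
have l2 a1 a2 b2 : linear (fun b1 => ybe_term A a1 b1 a2 b2).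
  move=> c x y; rewrite /ybe_term; move: (dot A) => D; rewrite -lin3.
  by congr (_ + _ - _); rewrite ?linearP ?lE !(pure_linl, pure_linr).
have l3 a1 b1 b2 : linear (fun a2 => ybe_term A a1 b1 a2 b2).
  move=> c x y; rewrite /ybe_term -lin3.
  by congr (_ + _ - _); rewrite ?linearP !(pure_linl, pure_linr).
have l4 a1 b1 a2 : linear (ybe_term A a1 b1 a2).
  move=> c x y; rewrite /ybe_term -lin3.
  by congr (_ + _ - _); rewrite ?linearP !(pure_linl, pure_linr).
pose F a1 b1 := tens_lift (bilin (ybe_term A a1 b1)).
have FE a1 b1 a2 b2 : F a1 b1 (pure a2 b2) = ybe_term A a1 b1 a2 b2.
  by rewrite /F tens_liftE bilinE.
pose G := tens_lift (bilin F).
have GE a1 b1 : G (pure a1 b1) = F a1 b1.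
  rewrite /G tens_liftE bilinE // => w c x y; apply: tens_lift_unique => u v;
    rewrite !lE !FE; [exact: l2 | exact: l1].
have E m (a' b' : 'I_m -> V) :
    G (\sum_i pure (a' i) (b' i)) (\sum_i pure (a' i) (b' i))
    = \sum_i \sum_j ybe_term A (a' i) (b' i) (a' j) (b' j).
  have GS t : G (\sum_i pure (a' i) (b' i)) t = \sum_i G (pure (a' i) (b' i)) t.
    by rewrite linear_sum sum_lfunE.
  rewrite GS; apply: eq_bigr => i _.
  by rewrite GE linear_sum; apply: eq_bigr => j _; apply: FE.
by move=> h0 m a' b' h; rewrite -E -h E.
Qed.

Record is_ad_bialgebra A (Ds Dp : 'Hom(V, tens V V)) : Prop :=
  IsAdBialgebra {
  adb_alg : is_antidendriform A;
  adb_coalg : is_antidendriform (AdOps (dual_op Ds) (dual_op Dp));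
  adb1 : forall x y, Dp (dot A x y) =
    tens_map (Rmul (dot A) y) \1 (Dp x) - tens_map \1 (succ A x) (Dp y);
  adb2 : forall x y, Ds (dot A x y) =
    tens_map \1 (dot A x) (Ds y) - tens_map (Rmul (prec A) y) \1 (Ds x);
  adb3 : forall x y, (Ds + Dp) (prec A x y) =
    tens_map (Rmul (prec A) y) \1 ((Ds + Dp) x)
    - tens_map \1 (prec A x) (Ds y);
  adb4 : forall x y, (Ds + Dp) (succ A x y) =
    tens_map \1 (succ A x) ((Ds + Dp) y)
    - tens_map (Rmul (succ A) y) \1 (Dp x);
  adb5 : forall x y,
    tens_map (succ A x) \1 ((Ds + Dp) y)
    + tens_map (Rmul (succ A) y) \1 (tens_flip (Ds x))
    - tens_map \1 (prec A y) (tens_flip (Dp x))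
    - tens_map \1 (Rmul (prec A) x) ((Ds + Dp) y) = 0;
  adb6 : forall x y,
    tens_map \1 (Rmul (dot A) y) (Ds x)
    + tens_map (succ A y) \1 (Ds x)
    - tens_flip (tens_map \1 (Rmul (prec A) x) (Dp y))
    - tens_flip (tens_map (dot A x) \1 (Dp y)) = 0 }.

Definition Dsucc A r : 'Hom(V, tens V V) :=
  linfun (fun x =>
    - (tens_map (Rmul (prec A) x) \1 + tens_map \1 (dot A x))%VF r).

Definition Dprec A r : 'Hom(V, tens V V) :=
  linfun (fun x =>
    (tens_map (Rmul (dot A) x) \1 + tens_map \1 (succ A x))%VF r).

Record is_quasitriangular A r : Prop := IsQuasitriangular {
  qt_bialg : is_ad_bialgebra A (Dsucc A r) (Dprec A r);
  qt_ybe : ADYBE A r;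
  qt_inv : invariant A (r + tens_flip r) }.

Record is_factorizable A r : Prop := IsFactorizable {
  fact_qt : is_quasitriangular A r;
  fact_bij : bijective (Tmap (r + tens_flip r)) }.

Definition dual_ad A r : ad_ops (dual V) := AdOps
  (bilin (fun zeta eta : dual V =>
     - dual_end (Rmul (dot A) (Tmap r zeta)) eta
     - dual_end (prec A (Tmap (tens_flip r) eta)) zeta))
  (bilin (fun zeta eta : dual V =>
     dual_end (Rmul (succ A) (Tmap r zeta)) eta
     + dual_end (dot A (Tmap (tens_flip r) eta)) zeta)).

Definition TT r : 'Hom(dual V, (V * V)%type) :=
  linfun (fun zeta : dual V => (Tmap r zeta, - Tmap (tens_flip r) zeta)).

Lemma TTE r zeta : TT r zeta = (Tmap r zeta, - Tmap (tens_flip r) zeta).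
Proof.
by rewrite /TT linfunE // => a x y; rewrite !linearP.
Qed.

Lemma tens_map_Dlin (p q : 'Hom(V, 'End(V))) t :
  linear (fun x => (tens_map (p x) \1 + tens_map \1 (q x))%VF t).
Proof.
move=> a x y.
suff -> : (tens_map (p (a *: x + y)) \1 + tens_map \1 (q (a *: x + y)))%VF
  = a *: (tens_map (p x) \1 + tens_map \1 (q x))%VF
    + (tens_map (p y) \1 + tens_map \1 (q y))%VF
  by rewrite !(add_lfunE, scale_lfunE).
apply: tens_lift_unique => u v.
rewrite !(add_lfunE, scale_lfunE, tens_mapE, id_lfunE) !linearP.
rewrite !(add_lfunE, scale_lfunE) pure_linl pure_linr scalerDr.
by rewrite addrACA.
Qed.

Lemma DsuccE A r x : Dsucc A r x =
  - (tens_map (Rmul (prec A) x) \1 + tens_map \1 (dot A x))%VF r.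
Proof.
by rewrite /Dsucc linfunE // => a u v; rewrite tens_map_Dlin opprD scalerN.
Qed.

Lemma DprecE A r x : Dprec A r x =
  (tens_map (Rmul (dot A) x) \1 + tens_map \1 (succ A x))%VF r.
Proof. by rewrite /Dprec linfunE //; apply: tens_map_Dlin. Qed.

Lemma dual_endP a (f g : 'End(V)) (z : dual V) :
  dual_end (a *: f + g) z = a *: dual_end f z + dual_end g z.
Proof.
by apply/lfunP => w; rewrite !(add_lfunE, scale_lfunE, dual_endE) linearP.
Qed.

Lemma dual_bilinE (p q : 'Hom(V, 'End(V))) (S T : 'Hom(dual V, V))
    (zeta eta : dual V) :
  bilin (fun zeta eta : dual V =>
    dual_end (p (S zeta)) eta + dual_end (q (T eta)) zeta) zeta eta
  = dual_end (p (S zeta)) eta + dual_end (q (T eta)) zeta.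
Proof.
rewrite bilinE // => w a x y; rewrite !linearP dual_endP scalerDr.
  by rewrite addrACA.
by rewrite addrACA.
Qed.

Lemma dual_ad_precE A r (zeta eta : dual V) :
  prec (dual_ad A r) zeta eta =
    dual_end (Rmul (succ A) (Tmap r zeta)) eta
    + dual_end (dot A (Tmap (tens_flip r) eta)) zeta.
Proof. exact: dual_bilinE. Qed.

Lemma dual_ad_succE A r (zeta eta : dual V) :
  succ (dual_ad A r) zeta eta =
    - dual_end (Rmul (dot A) (Tmap r zeta)) eta
    - dual_end (prec A (Tmap (tens_flip r) eta)) zeta.
Proof.
rewrite /= bilinE // => w a x y; rewrite !linearP dual_endP !opprD scalerDr.
  by rewrite -!scalerN addrACA.
by rewrite -!scalerN addrACA.
Qed.

Lemma tens_pair_map (f g : 'End(V)) t (zeta eta : dual V) :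
  tens_pair (tens_map f g t) zeta eta =
  tens_pair t (dual_end f zeta) (dual_end g eta).
Proof.
pose F z e : 'Hom(tens V V, k^o) := linfun (fun t => tens_pair t z e : k^o).
have FE z e u : tens_pair u z e = F z e u.
  by rewrite /F linfunE //; apply: tens_pair_lin.
rewrite !FE -comp_lfunE.
suff -> : (F zeta eta \o tens_map f g)%VF = F (dual_end f zeta) (dual_end g eta)
  by [].
apply: tens_lift_unique => u v.
by rewrite comp_lfunE tens_mapE -!FE !tens_pairE !dual_endE.
Qed.

Lemma tens_pair_flip t (zeta eta : dual V) :
  tens_pair (tens_flip t) zeta eta = tens_pair t eta zeta.
Proof.
pose F z e : 'Hom(tens V V, k^o) := linfun (fun t => tens_pair t z e : k^o).
have FE z e u : tens_pair u z e = F z e u.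
  by rewrite /F linfunE //; apply: tens_pair_lin.
rewrite !FE -comp_lfunE.
suff -> : (F zeta eta \o tens_flip)%VF = F eta zeta by [].
apply: tens_lift_unique => u v.
by rewrite comp_lfunE tens_flipE -!FE !tens_pairE; apply: mulrC.
Qed.

Lemma dual_end1 (z : dual V) : dual_end \1 z = z.
Proof. by apply/lfunP => v; rewrite dual_endE id_lfunE. Qed.

(* The operations of dual_ad are those dual to Dsucc and Dprec. *)
Lemma dual_ad_dual_op A r :
  dual_ad A r = AdOps (dual_op (Dsucc A r)) (dual_op (Dprec A r)).
Proof.
have tpD (z e : dual V) t u :
    tens_pair (t + u) z e = tens_pair t z e + tens_pair u z e.
  by rewrite /tens_pair linearD.
have tpN (z e : dual V) t : tens_pair (- t) z e = - tens_pair t z e.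
  by rewrite /tens_pair linearN.
have -> : dual_ad A r = AdOps (succ (dual_ad A r)) (prec (dual_ad A r)) by [].
congr AdOps; apply/lfunP => zeta; apply/lfunP => eta; apply/lfunP => x;
  rewrite dual_opE ?dual_ad_precE ?dual_ad_succE.
  rewrite DsuccE tpN add_lfunE tpD !tens_pair_map !dual_end1 opprD addrC.
  rewrite !(add_lfunE, opp_lfunE) !dual_endE RmulE; congr (- _ - _).
    by rewrite -tens_pair_flip -TmapE dual_endE RmulE.
  by rewrite -TmapE dual_endE /dot !add_lfunE.
rewrite DprecE add_lfunE tpD !tens_pair_map !dual_end1 addrC.
rewrite !(add_lfunE, opp_lfunE) !dual_endE RmulE; congr (_ + _).
  by rewrite -tens_pair_flip -TmapE dual_endE RmulE /dot !add_lfunE.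
by rewrite -TmapE dual_endE.
Qed.

End Bialgebra.

(* Main.v *)
(* Write T, S for T_r, T_{tau r}, and P = T + S. Paired with zeta (x) eta (x)
   theta, the AD-YBE reads
     zeta (dot (S eta) (S theta)) + eta (succ (S theta) (T zeta))
       = theta (prec (T zeta) (T eta)),
   i.e. T preserves prec. Invariance of r + tau r gives exchange rules for P;
   trading S for P - T in the AD-YBE by means of them shows that T and -S
   preserve both operations. Hence zeta |-> (T zeta, - S zeta) is a morphism
   from the dual of A to A (+) A, and the difference of its two components is
   the bijection P. *)
Require Import Defs.
From mathcomp Require Import all_boot all_algebra.
From mathcomp Require Import ring.

Set Implicit Arguments.
Unset Strict Implicit.
Unset Printing Implicit Defensive.

Import GRing.Theory.
Local Open Scope ring_scope.

(** The coordinate forms of a basis already separate vectors, so identities in [V] can be checked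
    after pairing with a functional. *)
Lemma dual_separates (k : fieldType) (V : vectType k) (u v : V) :
  (forall e : dual V, e u = e v) -> u = v.
Proof.
move=> uv; rewrite (coord_vbasis (memvf u)) (coord_vbasis (memvf v)).
apply: eq_bigr => i _; congr (_ *: _).
have cl : linear (coord (vbasis {:V}) i : V -> k^o).
  by move=> a x y; rewrite linearP.
by have := uv (linfun (coord (vbasis {:V}) i : V -> k^o)); rewrite !linfunE.
Qed.

Section Pairing.
Variables (k : fieldType) (V : vectType k).
Implicit Types (r : tens V V) (zeta eta theta : dual V).

Lemma tens_pairD (U W : vectType k) (t u : tens U W) (z : dual U) (e : dual W) :
  tens_pair (t + u) z e = tens_pair t z e + tens_pair u z e.
Proof. by rewrite /tens_pair linearD. Qed.

Lemma tens_pairN (U W : vectType k) (t : tens U W) (z : dual U) (e : dual W) :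
  tens_pair (- t) z e = - tens_pair t z e.
Proof. by rewrite /tens_pair linearN. Qed.

Lemma tens_pair_sum (U W : vectType k) (n : nat) (t : 'I_n -> tens U W)
    (z : dual U) (e : dual W) :
  tens_pair (\sum_i t i) z e = \sum_i tens_pair (t i) z e.
Proof. by rewrite /tens_pair linear_sum. Qed.

(** As a functional on [tens V V], this lets [tens_pair] act on the triple tensor product associated
    to the left. *)
Definition dual_pure zeta eta : dual (tens V V) :=
  linfun (fun t => tens_pair t zeta eta : k^o).

Lemma dual_pureE zeta eta u v : dual_pure zeta eta (pure u v) = zeta u * eta v.
Proof. by rewrite /dual_pure linfunE ?tens_pairE //; apply: tens_pair_lin. Qed.

(** Flipping [r] exchanges the arguments of the pairing, so the two maps are transposes of each
    other. *)
Lemma TmapC r zeta eta : eta (Tmap r zeta) = zeta (Tmap (tens_flip r) eta).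
Proof. by rewrite !TmapE tens_pair_flip. Qed.

Lemma TmapD r s zeta : Tmap (r + s) zeta = Tmap r zeta + Tmap s zeta.
Proof.
by apply: dual_separates => e; rewrite linearD /= !TmapE tens_pairD.
Qed.

Lemma Tmap_sumE (n : nat) (a b : 'I_n -> V) zeta :
  Tmap (\sum_i pure (a i) (b i)) zeta = \sum_i (zeta (a i) : k) *: b i.
Proof.
apply: dual_separates => e; rewrite TmapE tens_pair_sum linear_sum.
by apply: eq_bigr => i _; rewrite tens_pairE linearZ.
Qed.

Lemma Tmap_flip_sumE (n : nat) (a b : 'I_n -> V) zeta :
  Tmap (tens_flip (\sum_i pure (a i) (b i))) zeta
  = \sum_i (zeta (b i) : k) *: a i.
Proof.
rewrite linear_sum -Tmap_sumE; congr (Tmap _ _).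
by apply: eq_bigr => i _ /=; rewrite tens_flipE.
Qed.

Lemma bilinear_sum (W : vectType k) (p : 'Hom(V, 'End(V)))
    (e : 'Hom(V, W)) (n : nat) (c d : 'I_n -> k) (a b : 'I_n -> V) :
  e (p (\sum_i c i *: a i) (\sum_j d j *: b j))
  = \sum_i \sum_j (c i * d j) *: e (p (a i) (b j)).
Proof.
rewrite (linear_sum p) sum_lfunE (linear_sum e); apply: eq_bigr => i _.
rewrite (linear_sum (p _)) (linear_sum e); apply: eq_bigr => j _.
by rewrite !linearZ /= scale_lfunE linearZ scalerA mulrC.
Qed.

End Pairing.

Lemma bilinearNN (k : fieldType) (V : vectType k) (p : 'Hom(V, 'End(V)))
    (u v : V) :
  p (- u) (- v) = p u v.
Proof. by rewrite (linearN p) opp_lfunE linearN opprK. Qed.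

Section Morphism.
Variables (k : fieldType) (V : vectType k) (A : ad_ops V) (r : tens V V).
Implicit Types (zeta eta theta : dual V) (x : V).

Local Notation T := (Tmap r).
Local Notation S := (Tmap (tens_flip r)).

Lemma dotE x y : dot A x y = succ A x y + prec A x y.
Proof. by rewrite /dot !add_lfunE. Qed.

(** For [r] a sum of [pure (a i) (b i)], contracting the [b i] leaves the [a i] assembled into a
    value of [S], and contracting the [a i] leaves the [b i] assembled into a value of [T]. *)
Lemma ADYBE_pair : ADYBE A r -> forall zeta eta theta,
  zeta (dot A (S eta) (S theta)) + eta (succ A (S theta) (T zeta))
  = theta (prec A (T zeta) (T eta)).
Proof.
have [n [a [b rE]]] := tens_decomp r.
move=> /(_ n a b rE) ybe zeta eta theta; apply/eqP; rewrite -subr_eq0.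
have := congr1 (fun t => tens_pair t (dual_pure zeta eta) theta) ybe.
rewrite /= {2}/tens_pair linear0 tens_pair_sum => ybe0; rewrite -{}ybe0.
rewrite rE !(Tmap_flip_sumE, Tmap_sumE) !bilinear_sum.
rewrite -sumrN -!big_split; apply/eqP.
apply: eq_bigr => i _.
rewrite tens_pair_sum -sumrN -!big_split; apply: eq_bigr => j _.
rewrite /ybe_term !(tens_pairD, tens_pairN, tens_pairE, dual_pureE).
by rewrite /GRing.scale /=; ring.
Qed.

Hypothesis inv : Defs.invariant A (r + tens_flip r).

Local Notation P := (Tmap (r + tens_flip r)).

Lemma Tmap_symm zeta eta : eta (P zeta) = zeta (P eta).
Proof. by rewrite !TmapD !linearD /= (TmapC r zeta) (TmapC r eta) addrC. Qed.

(** The symmetry [Tmap_symm] moves [P] off the functional twisted by [Rmul p x], so that [p]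
    receives [P eta] as its left argument. *)
Lemma invariant_pair (p q : 'Hom(V, 'End(V))) x zeta eta :
  (tens_map (Rmul p x) \1 + tens_map \1 (q x))%VF (r + tens_flip r) = 0 ->
  zeta (p (P eta) x) = - eta (q x (P zeta)).
Proof.
move/(congr1 (fun t => tens_pair t zeta eta)).
rewrite /= [in RHS]/tens_pair linear0 add_lfunE tens_pairD !tens_pair_map.
rewrite !dual_end1 -!TmapE Tmap_symm !dual_endE RmulE => /eqP.
by rewrite addr_eq0 => /eqP.
Qed.

Lemma invariant_prec x zeta eta :
  zeta (prec A (P eta) x) = - eta (dot A x (P zeta)).
Proof. by apply: invariant_pair; case: (inv x). Qed.

Lemma invariant_dot x zeta eta :
  zeta (dot A (P eta) x) = - eta (succ A x (P zeta)).
Proof. by apply: invariant_pair; case: (inv x). Qed.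

(** Subtract [invariant_prec] from [invariant_dot]: the terms [eta (succ A x (P zeta))] cancel. *)
Lemma invariant_succ x zeta eta :
  zeta (succ A (P eta) x) = eta (prec A x (P zeta)).
Proof.
have := invariant_dot x zeta eta.
rewrite dotE linearD /= invariant_prec dotE linearD /=.
by move/(canRL (subrK _)) => ->; rewrite addKr.
Qed.

Hypothesis ybe : ADYBE A r.

Lemma dual_ad_prec_pair zeta eta x :
  prec (dual_ad A r) zeta eta x =
    eta (succ A x (T zeta)) + zeta (dot A (S eta) x).
Proof. by rewrite dual_ad_precE add_lfunE !dual_endE RmulE. Qed.

Lemma dual_ad_succ_pair zeta eta x :
  succ (dual_ad A r) zeta eta x =
    - eta (dot A x (T zeta)) - zeta (prec A (S eta) x).
Proof. by rewrite dual_ad_succE add_lfunE !opp_lfunE !dual_endE RmulE. Qed.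

Let lin := (TmapD, linearD, add_lfunE).

(** Transposing [T] to [S theta] turns the claim into [ADYBE_pair], up to the order of two
    summands. *)
Lemma Tmap_prec zeta eta :
  T (prec (dual_ad A r) zeta eta) = prec A (T zeta) (T eta).
Proof.
apply: dual_separates => theta.
by rewrite TmapC dual_ad_prec_pair -ADYBE_pair // addrC.
Qed.

(** With [T zeta = P zeta - S zeta], [invariant_succ] rewrites the right-hand side; [invariant_prec]
    then replaces the resulting [zeta (prec A (T eta) (S theta))], and what is left over is the
    AD-YBE at [eta], [theta], [zeta]. *)
Lemma Tmap_succ zeta eta :
  T (succ (dual_ad A r) zeta eta) = succ A (T zeta) (T eta).
Proof.
apply: dual_separates => theta; rewrite TmapC dual_ad_succ_pair.
have := invariant_succ (T eta) theta zeta.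
have := invariant_prec (S theta) zeta eta.
have := ADYBE_pair ybe eta theta zeta.
(* Generalizing [dot A] keeps [add_lfunE] from splitting it into [succ A] and [prec A]. *)
move: (dot A) => D; rewrite !lin /=.
by move=> /esym Ey /(canRL (addrK _)) Ep /(canRL (addrK _)) ->;
  rewrite Ey Ep; ring.
Qed.

(** The two signs on the right cancel while the one on the left stays; this is the sign that the
    exchange rules produce. *)
Lemma Tmap_flip_succ zeta eta :
  - S (succ (dual_ad A r) zeta eta) = succ A (- S zeta) (- S eta).
Proof.
apply: dual_separates => theta.
rewrite bilinearNN linearN /= -TmapC dual_ad_succ_pair.
have := invariant_prec (T theta) zeta eta.
have := invariant_dot (S zeta) eta theta.
have := ADYBE_pair ybe eta theta zeta.
move: (dot A) => D; rewrite !lin /=.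
by move=> /esym Ey /(canRL (addrK _)) Ed /(canRL (addKr _)) ->;
  rewrite Ey Ed; ring.
Qed.

Lemma Tmap_flip_prec zeta eta :
  - S (prec (dual_ad A r) zeta eta) = prec A (- S zeta) (- S eta).
Proof.
apply: dual_separates => theta.
rewrite bilinearNN linearN /= -TmapC dual_ad_prec_pair.
have := invariant_succ (T zeta) eta theta.
have := invariant_prec (S eta) theta zeta.
have := ADYBE_pair ybe zeta eta theta.
move: (dot A) => D; rewrite !lin /=.
by move=> /esym Ey /(canRL (addrK _)) Ep /(canRL (addrK _)) ->;
  rewrite Ey Ep; ring.
Qed.

Lemma TT_morph zeta eta :
  TT r (succ (dual_ad A r) zeta eta)
    = succ (ad_sum A A) (TT r zeta) (TT r eta) /\
  TT r (prec (dual_ad A r) zeta eta)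
    = prec (ad_sum A A) (TT r zeta) (TT r eta).
Proof.
rewrite !(proj1 (ad_sumE _ _ _ _)) !(proj2 (ad_sumE _ _ _ _)) !TTE /=.
by rewrite Tmap_succ Tmap_prec Tmap_flip_succ Tmap_flip_prec.
Qed.

End Morphism.

(** The minus sign in the second component of [TT] makes this difference the map assumed bijective;
    injectivity of [TT] and the decomposition both rest on it. *)
Lemma TT_sub (k : fieldType) (V : vectType k) (r : tens V V) (zeta : dual V) :
  (TT r zeta).1 - (TT r zeta).2 = Tmap (r + tens_flip r) zeta.
Proof. by rewrite TTE TmapD opprK. Qed.

Theorem proposition4p3 (k : fieldType) (V : vectType k) (A : ad_ops V)
    (r : tens V V) (hr : is_factorizable A r) :
  is_ad_subalgebra (ad_sum A A) (limg (TT r)) /\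
  ad_isomorphic (ad_sub (ad_sum A A) (limg (TT r))) (dual_ad A r) /\
  (forall x : V, exists! p : V * V,
     p \in limg (TT r) /\ x = (p.1 - p.2)%R).
Proof.
case: hr => [[_ ybe inv] Pbij].
have Pinj := bij_inj Pbij.
have TTinj : injective (TT r).
  by move=> z e ze; apply: Pinj; rewrite -!TT_sub ze.
have TTker : lker (TT r) == 0%VS by apply/lker0P.
have subA : is_ad_subalgebra (ad_sum A A) (limg (TT r)).
  move=> _ _ /memv_imgP[z _ ->] /memv_imgP[e _ ->].
  have [<- <-] := TT_morph inv ybe z e.
  by split; apply/memv_img/memvf.
split=> //; split.
(* The isomorphism is the inverse of [TT r] on its image; [(TT r)^-1] is a genuine left inverse
   because the kernel is trivial. *)
- pose f := ((TT r)^-1 \o linfun (@vsval k _ (limg (TT r))))%VF.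
  have fE u : f u = (TT r)^-1%VF (vsval u) by rewrite comp_lfunE lfunE.
  have fK z : (TT r)^-1%VF (TT r z) = z by apply: lker0_lfunK.
  have TTf u : TT r (f u) = vsval u.
    by rewrite fE; have /memv_imgP[z _ ->] := subvsP u; rewrite fK.
  exists f; split.
  + exists (fun z => vsproj (limg (TT r)) (TT r z)) => [u|z].
      by rewrite TTf vsvalK.
    by rewrite fE vsprojK ?fK // memv_img ?memvf.
  (* Multiplicativity of the inverse is checked after applying the injective morphism [TT r]. *)
  + move=> u v; apply: TTinj; rewrite (TT_morph inv ybe _ _).1 !TTf.
    exact: (ad_subE _ _ subA).1.
  + move=> u v; apply: TTinj; rewrite (TT_morph inv ybe _ _).2 !TTf.
    exact: (ad_subE _ _ subA).2.
- move=> x; case: Pbij => Q PK QK.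
  (* Elements of the image are [TT r z], with difference [P z]; hence [z] must be the preimage
     [Q x]. *)
  exists (TT r (Q x)); split; first by rewrite memv_img ?memvf // TT_sub QK.
  by move=> p [/memv_imgP[z _ ->] ->]; rewrite TT_sub PK.
Qed.
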